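(* Let $X=\{x_1,\ldots,x_m\}$ be a finite metric space with $m$ distinct points and of diameter at most one, let $M_X=(d(x_i,x_j))_{1\le i,j\le m}$ be its distance matrix, let $r_i=(d(x_i,x_1),\ldots,d(x_i,x_m))\in\mathbb{R}^m$ be its rows, and let $P_X=\operatorname{conv}\{r_1,\ldots,r_m\}\subseteq\mathbb{R}^m$. The following are equivalent: (i) $S'(X)$ is a Choquet simplex; (ii) $P_X$ is an $(m-1)$-simplex; (iii) the rows $r_1,\ldots,r_m$ of $M_X$ are affinely independent; (iv) the $m\times(m+1)$ matrix whose $i$-th row is $(1,d(x_i,x_1),\ldots,d(x_i,x_m))$ has rank $m$; (v) $\ker M_X\cap H_0=\{0\}$, where $H_0=\{a\in\mathbb{R}^m:\sum_{i=1}^m a_i=0\}$.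
   Context: The construction $S'$: Let $(X,d)$ be a nonempty separable metric space with $\operatorname{diam}(X)\le 1$. For a sequence $D=(d_n)_{n\ge 1}$ (repetitions allowed) whose terms form a dense subset of $X$, put $\iota_D:X\to[0,1]^{\mathbb{N}}$, $\iota_D(x)=(d(x,d_1),d(x,d_2),\ldots)$, and let $S'_D(X)$ be the closed convex hull of $\iota_D(X)$ in $[0,1]^{\mathbb{N}}$ (product topology). Up to affine homeomorphism $S'_D(X)$ does not depend on the choice of $D$ (a known result of Sabok), and $S'(X)$ denotes $S'_D(X)$ for any such $D$. A compact metrizable convex set $K$ (in a Hausdorff locally convex space) is a Choquet simplex if each point of $K$ is the barycenter of a unique Borel probability measure carried by the set $\operatorname{ext}(K)$ of extreme points of $K$. An $(m-1)$-simplex is the convex hull of $m$ affinely independent points. *)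

(* Defs.v *)
From HB Require Import structures.
From mathcomp Require Import all_boot all_order all_algebra.
From mathcomp Require Import all_classical all_reals all_analysis.
Set Implicit Arguments. Unset Strict Implicit. Unset Printing Implicit Defensive.
Import Order.TTheory GRing.Theory Num.Theory.
Import numFieldNormedType.Exports.
Local Open Scope classical_set_scope.
Local Open Scope ring_scope.

(* R^N with the product topology; it is proved below to be a locally convex
   space. *)
Definition real_sequence (R : realType) : Type := {ptws nat -> R^o}.

HB.instance Definition _ (R : realType) :=
  Uniform.copy (real_sequence R) {ptws nat -> R^o}.
HB.instance Definition _ (R : realType) :=
  GRing.Lmodule.copy (real_sequence R) (nat -> R^o).

Section real_sequence_tvs.
Variable R : realType.
Local Notation E := (real_sequence R).

Let cvg_coord (F : set_system E) (f : E) : Filter F ->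
  (forall n, (fun g : E => g n) @ F --> f n) -> F --> f.
Proof.
move=> FF cf; apply/cvg_sup => n U [V [[W oW <-]]] WfN WU.
by apply: (filterS WU); apply: cf; apply: open_nbhs_nbhs; split.
Qed.

Let coord_cts (n : nat) : continuous (fun g : E => g n).
Proof. exact: (@proj_continuous nat (fun=> R^o)). Qed.

Let add_cts : continuous (fun x : E * E => x.1 + x.2).
Proof.
move=> [f g].
apply: (@cvg_coord ((fun x : E * E => x.1 + x.2) @ nbhs (f, g)) (f + g)) => n.
apply: (@cvgD R R^o _ (nbhs (f, g)) _
  (fun x : E * E => x.1 n) (fun x : E * E => x.2 n) (f n) (g n)).
  apply: (@cvg_comp _ _ _ (fun x : E * E => x.1) (fun h : E => h n)
    (nbhs (f, g)) (nbhs f)); [exact: cvg_fst|exact: coord_cts].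
apply: (@cvg_comp _ _ _ (fun x : E * E => x.2) (fun h : E => h n)
  (nbhs (f, g)) (nbhs g)); [exact: cvg_snd|exact: coord_cts].
Qed.

Let scale_cts : continuous (fun z : R^o * E => z.1 *: z.2).
Proof.
move=> [a g].
apply: (@cvg_coord ((fun z : R^o * E => z.1 *: z.2) @ nbhs (a, g)) (a *: g)).
move=> n; apply: (@cvgM R _ (nbhs (a, g)) _
  (fun z : R^o * E => z.1) (fun z : R^o * E => z.2 n) a (g n)).
  exact: cvg_fst.
apply: (@cvg_comp _ _ _ (fun z : R^o * E => z.2) (fun h : E => h n)
  (nbhs (a, g)) (nbhs g)); [exact: cvg_snd|exact: coord_cts].
Qed.

Let locally_cvx :
  exists2 B : set_system E, (forall b, b \in B -> convex_set b) & basis B.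
Proof.
exists [set U | open U /\ convex_set U]; first by move=> b /set_mem[].
split=> [U []//|f].
have FF : Filter (filter_from
    [set U : set E | (open U /\ convex_set U) /\ U f] id).
  apply: filter_from_filter.
    exists setT; split=> //; split; first exact: openT.
    by move=> *; exact: in_setT.
  move=> U V [[oU cU] Uf] [[oV cV] Vf]; exists (U `&` V) => //.
  split=> //; split; first exact: openI.
  move=> x y t /set_mem[Ux Vx] /set_mem[Uy Vy]; rewrite in_setI.
  by apply/andP; split; [apply: cU|apply: cV]; exact/mem_set.
apply: (@cvg_coord _ f FF) => n W /=.
have [B cB [oB bB]] := @locally_convex R R^o.
move=> /(bB (f n))[V [BV Vfn] VW].
exists ((fun g : E => g n) @^-1` V); last by move=> g /VW.
split=> //; split.
  by apply: open_comp; [move=> *; exact: coord_cts|exact: oB].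
move=> x y t /set_mem/= Vx /set_mem/= Vy; apply/mem_set => /=.
by apply/set_mem/(cB V (mem_set BV)); exact/mem_set.
Qed.

HB.instance Definition _ :=
  PreTopologicalNmodule_isTopologicalNmodule.Build E add_cts.
HB.instance Definition _ :=
  TopologicalNmodule_isTopologicalLmodule.Build R E scale_cts.
HB.instance Definition _ := Uniform_isTvs.Build R E locally_cvx.

End real_sequence_tvs.

Section convex_geometry.
Variables (R : realType) (E : lmodType R).

Definition convex_hull (A : set E) : set E := smallest (@convex_set R E) A.

Definition extreme_points (K : set E) : set E :=
  [set x | K x /\ forall y z (t : R), K y -> K z -> 0 < t -> t < 1 ->
    x = t *: y + (1 - t) *: z -> y = x /\ z = x].

Definition affinely_independent n (p : 'I_n -> E) :=
  forall a : 'I_n -> R,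
    \sum_(i < n) a i = 0 -> \sum_(i < n) a i *: p i = 0 -> forall i, a i = 0.

(* k is the dimension: a k-simplex has k + 1 vertices. *)
Definition is_simplex k (P : set E) :=
  exists p : 'I_k.+1 -> E, affinely_independent p /\ P = convex_hull (range p).

End convex_geometry.

(* The subspace topology of K is induced by a metric on K; rho is irrelevant
   outside K. Nonnegativity of rho on K follows from the other axioms. *)
Definition metrizable_set (R : realType) (T : topologicalType) (K : set T) :=
  exists rho : T -> T -> R,
    [/\ forall x y, K x -> K y -> (rho x y = 0 <-> x = y),
        forall x y, K x -> K y -> rho x y = rho y x,
        forall x y z, K x -> K y -> K z -> rho x z <= rho x y + rho y z &
        forall x (U : set T), K x ->
          (within K (nbhs x) U <->
           exists2 e : R, 0 < e & forall y, K y -> rho x y < e -> U y)].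

(* Measurable types have to be pointed; 0 serves as the point. *)
Definition pointed_tvs (R : realType) (E : tvsType R) : Type := E.

HB.instance Definition _ (R : realType) (E : tvsType R) :=
  Choice.on (pointed_tvs E).
HB.instance Definition _ (R : realType) (E : tvsType R) :=
  isPointed.Build (pointed_tvs E) (0 : E).

Definition borel (R : realType) (E : tvsType R) :=
  g_sigma_algebraType (@open E : set (set (pointed_tvs E))).

HB.instance Definition _ (R : realType) (E : tvsType R) :=
  Measurable.on (borel E).

Section choquet.
Variables (R : realType) (E : tvsType R).

Definition barycenter (K : set E) (mu : probability (borel E) R) (x : E) :=
  forall f : {linear E -> R^o}, continuous f ->
    (\int[mu]_(y in K) (f y)%:E = (f x)%:E)%E.

(* A Borel probability measure on K is encoded as one on E that is
   concentrated on K; being carried by the extreme points implies this. When K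
   is compact and metrizable and E is Hausdorff, K is closed and its set of
   extreme points is a G_delta of K, so both are Borel sets. *)
Definition represents (K : set E) (mu : probability (borel E) R) (x : E) :=
  mu (extreme_points K) = 1%E /\ barycenter K mu x.

(* Equality of measures is equality on Borel sets: the value of a measure of
   the library on a nonmeasurable set is meaningless. *)
Definition choquet_simplex (K : set E) :=
  [/\ hausdorff_space E, compact K, metrizable_set R K, convex_set K &
      forall x, K x -> exists2 mu : probability (borel E) R,
        represents K mu x &
        forall nu : probability (borel E) R, represents K nu x ->
          forall B : set (borel E), measurable B -> nu B = mu B].

End choquet.

Section Sprime.
Variables (R : realType) (X : metricType R).

Definition dist_seq (D : nat -> X) (x : X) : real_sequence R :=
  fun n => mdist x (D n).

(* When the diameter of X is at most 1, this set lies in [0,1]^N, which is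
   closed and convex in R^N, so it is also the closed convex hull there. *)
Definition Sprime (D : nat -> X) : set (real_sequence R) :=
  closure (convex_hull (range (dist_seq D))).

Definition dist_mx m (x : 'I_m -> X) : 'M[R]_m :=
  \matrix_(i, j) mdist (x i) (x j).

End Sprime.

(* Main.v *)
From HB Require Import structures.
Require Import Defs.
From mathcomp Require Import all_boot all_order all_algebra.
From mathcomp Require Import all_classical all_reals all_analysis.
From mathcomp Require Import measurable_realfun ring.
Import Order.TTheory GRing.Theory Num.Theory.
Import numFieldNormedType.Exports.
Local Open Scope classical_set_scope.
Local Open Scope ring_scope.

(* A dense sequence in a finite metric space hits every point, so S'(X) is the
   convex hull of the m points p_i = (d(x_i, D_n))_n, and the p_i satisfy the
   same affine relations as the rows r_i. A coordinate n with D_n = x_i vanishes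
   at p_i and is positive at the other p_j, so the p_i are exactly the extreme
   points. Probability measures carried by them are convex weights, hence
   barycenters are unique iff the p_i are affinely independent: a nonzero affine
   relation splits into its positive and negative parts, giving two weights with
   the same barycenter. If conv {r_i} is an (m-1)-simplex, then its m affinely
   independent vertices are affine combinations of the m rows, and comparing
   ranks shows that the rows are affinely independent. *)

(** * Convex hulls and extreme points of finite families *)

Section convex_hull_of_finite_family.
Variables (R : realType) (E : lmodType R).

Lemma conv_lmodE (y z : convex_lmodType E) (l : {i01 R}) :
  conv l y z = l%:num *: (y : E) + (1 - l%:num) *: (z : E).
Proof. by []. Qed.

Lemma convex_set_convex_hull (A : set E) : convex_set (convex_hull A).
Proof.
move=> y z l /set_mem Ky /set_mem Kz; apply/mem_set => C [cC AC].
by apply/set_mem/cC; apply/mem_set; [exact: Ky|exact: Kz].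
Qed.

(** [convex_set] speaks of two points only, so the proof is an induction over lists of indices, with
    partial sums normalised by their total weight; the full index list has weight 1. *)
Lemma convex_set_sum (C : set E) n (p : 'I_n -> E) (t : 'I_n -> R) :
  convex_set C -> range p `<=` C -> (forall i, 0 <= t i) ->
  \sum_(i < n) t i = 1 -> C (\sum_(i < n) t i *: p i).
Proof.
move=> cC pC t0 t1.
suff H (s : seq 'I_n) : 0 < \sum_(i <- s) t i ->
    C ((\sum_(i <- s) t i)^-1 *: \sum_(i <- s) t i *: p i).
  have := H (index_enum 'I_n); rewrite t1 invr1 scale1r; apply; exact: ltr01.
elim: s => [|h s IH]; first by rewrite big_nil ltxx.
rewrite !big_cons; set u := \sum_(i <- s) t i => u0.
have uge0 : 0 <= u by apply: sumr_ge0.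
have Cph : C (p h) by apply: pC; exists h.
(* A tail of weight zero cannot be normalised, but then all its weights vanish and only [p h]
   remains. *)
have [u_eq0|u_neq0] := eqVneq u 0.
  have -> : \sum_(i <- s) t i *: p i = 0.
    have /eqP := u_eq0; rewrite psumr_eq0 // => /allP H.
    by rewrite big_seq big1 // => i /H /eqP ->; rewrite scale0r.
  rewrite u_eq0 !addr0 scalerA mulVf ?scale1r //.
  by move: u0; rewrite u_eq0 addr0 => /gt_eqF ->.
have u_gt0 : 0 < u by rewrite lt_neqAle eq_sym u_neq0.
have w0 : 0 <= t h / (t h + u) by rewrite divr_ge0 // ltW.
have w1 : t h / (t h + u) <= 1 by rewrite ler_pdivrMr // mul1r lerDl.
have := cC (p h) (u^-1 *: \sum_(i <- s) t i *: p i) (Itv01 w0 w1)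
  (mem_set Cph) (mem_set (IH u_gt0)).
move=> /set_mem; congr C; rewrite conv_lmodE /= !scalerA scalerDr scalerA mulrC.
by congr (_ *: _ + _ *: _); field; rewrite u_neq0 gt_eqF.
Qed.

Lemma convex_hull_rangeE n (p : 'I_n -> E) :
  convex_hull (range p) = [set y | exists t : 'I_n -> R,
    [/\ forall i, 0 <= t i, \sum_(i < n) t i = 1 &
        y = \sum_(i < n) t i *: p i]].
Proof.
apply/seteqP; split=> [y|y [t [t0 t1 ->]] C [cC pC]]; last exact: convex_set_sum.
apply=> {y}; split=> [y z l /set_mem[t [t0 t1 ->]] /set_mem[s [s0 s1 ->]]|].
  apply/mem_set; exists (fun i => l%:num * t i + (1 - l%:num) * s i); split.
  - by move=> i; rewrite addr_ge0 // mulr_ge0 // subr_ge0.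
  - by rewrite big_split -!mulr_sumr t1 s1 /= !mulr1 addrC subrK.
  - rewrite conv_lmodE !scaler_sumr -big_split /=.
    by apply: eq_bigr => i _; rewrite !scalerA -scalerDl.
move=> _ [i _ <-]; exists (fun j => (j == i)%:R); split=> //.
  by rewrite (bigD1 i) //= eqxx big1 ?addr0 // => j /negbTE ->.
rewrite (bigD1 i) //= eqxx scale1r big1 ?addr0 // => j /negbTE ->.
by rewrite scale0r.
Qed.

(** Some weight [t i] is nonzero. Either it is 1 and the point is [p i], or the point is a proper
    convex combination of [p i] and the normalised rest, so extremality identifies it with [p i]. *)
Lemma extreme_points_convex_hull n (p : 'I_n -> E) :
  extreme_points (convex_hull (range p)) `<=` range p.
Proof.
move=> y [+ ey]; rewrite convex_hull_rangeE => -[t [t0 t1 yE]].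
have [i ti0] : exists i, t i != 0.
  apply/not_existsP => H; move: t1; rewrite big1 => [/esym/eqP|i _].
    by rewrite oner_eq0.
  by apply: contrapT => /eqP/H.
have ti_gt0 : 0 < t i by rewrite lt_neqAle eq_sym ti0 t0.
have sE : t i + \sum_(j < n | j != i) t j = 1 by rewrite -t1 [RHS](bigD1 i).
have s0 : 0 <= \sum_(j < n | j != i) t j by apply: sumr_ge0.
have [ti1|ti1] := eqVneq (t i) 1.
  exists i => //; rewrite yE (bigD1 i) //= ti1 scale1r big1 ?addr0 // => j ji.
  have /eqP : \sum_(j < n | j != i) t j = 0.
    by apply: (addrI (t i)); rewrite sE ti1 addr0.
  rewrite psumr_eq0 // => /allP/(_ j); rewrite mem_index_enum ji.
  by move=> /(_ isT)/eqP ->; rewrite scale0r.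
have ti_lt1 : t i < 1 by rewrite lt_neqAle ti1 /= -sE lerDl.
have u0 : 0 < 1 - t i by rewrite subr_gt0.
have uE : \sum_(j < n | j != i) t j = 1 - t i by rewrite -sE addrC addKr.
exists i => //.
(* The remaining weights, rescaled by their total [1 - t i]. *)
pose s j := if j == i then 0 else t j / (1 - t i).
suff [] : p i = y /\ \sum_(j < n) s j *: p j = y by [].
apply: (ey _ _ (t i)) => //.
- by apply: sub_gen_smallest; exists i.
- rewrite convex_hull_rangeE; exists s; split=> //.
    by move=> j; rewrite /s; case: ifP => // _; rewrite divr_ge0 // ltW.
  rewrite (bigD1 i) //= {1}/s eqxx add0r (eq_bigr (fun j => t j / (1 - t i))).
    by rewrite -mulr_suml uE divff // gt_eqF.
  by move=> j /negbTE ji; rewrite /s ji.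
- rewrite yE (bigD1 i) //=; congr (_ + _).
  rewrite [in RHS](bigD1 i) //= {1}/s eqxx scale0r add0r scaler_sumr.
  apply: eq_bigr => j /negbTE ji; rewrite /s ji scalerA; congr (_ *: _).
  by rewrite mulrC divfK // gt_eqF.
Qed.

(** The functional [f] is nonnegative on the hull and vanishes there only at [p i]. If [p i] lies
    strictly between [y] and [z], then [f y] and [f z] are both zero, so both points are [p i]. *)
Lemma exposed_point_convex_hull n (p : 'I_n -> E) i (f : {linear E -> R^o}) :
  f (p i) = 0 -> (forall j, j != i -> 0 < f (p j)) ->
  extreme_points (convex_hull (range p)) (p i).
Proof.
move=> fi fj.
have fp_ge0 j : 0 <= f (p j).
  by have [->|/fj/ltW//] := eqVneq j i; rewrite fi.
have f_ge0 y : convex_hull (range p) y -> 0 <= f y.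
  rewrite convex_hull_rangeE => -[t [t0 _ ->]].
  by rewrite linear_sum sumr_ge0 // => j _; rewrite linearZ mulr_ge0 // fp_ge0.
have f_eq0 y : convex_hull (range p) y -> f y = 0 -> y = p i.
  rewrite convex_hull_rangeE => -[t [t0 t1 ->]].
  rewrite linear_sum => /eqP; rewrite psumr_eq0 => [/allP H|j _]; last first.
    by rewrite linearZ mulr_ge0 // fp_ge0.
  have tj j : j != i -> t j = 0.
    move=> ji; have := H j; rewrite mem_index_enum linearZ /= => /(_ isT).
    by rewrite mulf_eq0 (gt_eqF (fj _ ji)) orbF => /eqP.
  rewrite (bigD1 i) //= big1 => [|j /tj ->]; last by rewrite scale0r.
  by move: t1; rewrite (bigD1 i) //= big1 // !addr0 => ->; rewrite scale1r.
split=> [|y z t Ky Kz t0 t1 pE]; first by apply: sub_gen_smallest; exists i.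
have /eqP : f (p i) = 0 by [].
rewrite {1}pE linearD !linearZ /= paddr_eq0; last 2 first.
- by rewrite mulr_ge0 ?f_ge0 // ltW.
- by rewrite mulr_ge0 ?f_ge0 // subr_ge0 ltW.
rewrite !mulf_eq0 gt_eqF //= [1 - t == 0]gt_eqF ?subr_gt0 //=.
by move=> /andP[/eqP fy /eqP fz]; split; apply: f_eq0.
Qed.

End convex_hull_of_finite_family.

(** * Affine independence as a rank condition *)

Section affine_independence_of_rows.
Variable R : realType.

(** A row vector annihilates the bordered matrix from the left exactly when its entries sum to zero
    (the column of ones) and it is a linear relation between the rows of [M]. *)
Lemma affinely_independent_row_free m k (M : 'M[R]_(m, k)) :
  affinely_independent (fun i => row i M) <->
  row_free (row_mx (const_mx 1 : 'cV[R]_m) M).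
Proof.
have sumE (v : 'rV[R]_m) : v *m (const_mx 1 : 'cV[R]_m) = (\sum_i v 0 i)%:M.
  apply/matrixP => i j; rewrite !mxE !ord1 eqxx mulr1n.
  by apply: eq_bigr => l _; rewrite mxE mulr1.
split=> [ai|rf a a0 a1 i].
  apply: inj_row_free => v; rewrite mul_mx_row -row_mx0 => /eq_row_mx[v1 vM].
  apply/rowP => i; rewrite mxE; apply: (ai (v 0)).
    by move: v1; rewrite sumE => /matrixP/(_ 0 0); rewrite !mxE.
  by rewrite -mulmx_sum_row.
have /row_free_inj inj := rf.
suff /rowP/(_ i) : \row_j a j = 0 by rewrite !mxE.
apply: (inj 1%N); rewrite mul0mx mul_mx_row sumE mulmx_sum_row.
rewrite (eq_bigr a) => [|j _]; last by rewrite mxE.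
rewrite [X in row_mx _ X](_ : _ = 0) ?a0 ?raddf0 ?row_mx0 //.
by rewrite -[RHS]a1; apply: eq_bigr => j _; rewrite mxE.
Qed.

(** Since weights sum to 1, the matrix of the [q i] bordered by ones is the square weight matrix
    times the bordered matrix of the [r i]. The rank of a product is at most that of its right
    factor. *)
Lemma affinely_independent_spanning n k (q r : 'I_n -> 'rV[R]_k) :
  range q `<=` convex_hull (range r) ->
  affinely_independent q -> affinely_independent r.
Proof.
have rowsE (s : 'I_n -> 'rV[R]_k) : s = fun i => row i (\matrix_j s j).
  by apply/funext => i; rewrite rowK.
rewrite convex_hull_rangeE => qr; rewrite (rowsE q) (rowsE r).
move=> /affinely_independent_row_free qf; apply/affinely_independent_row_free.
have {}qr i : exists t : 'I_n -> R,
    \sum_j t j = 1 /\ q i = \sum_j t j *: r j.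
  by have [|t [_ t1 tE]] := qr (q i); [exists i|exists t].
have [t tP] := choice qr.
have tE : row_mx (const_mx 1 : 'cV[R]_n) (\matrix_i q i) =
    (\matrix_(i, j) t i j) *m row_mx (const_mx 1 : 'cV[R]_n) (\matrix_i r i).
  rewrite mul_mx_row; congr row_mx.
    apply/matrixP => i j; rewrite !mxE -[LHS](tP i).1.
    by apply: eq_bigr => l _; rewrite !mxE mulr1.
  apply/row_matrixP => i; rewrite row_mul mulmx_sum_row rowK (tP i).2.
  by apply: eq_bigr => l _; rewrite !mxE rowK.
move: qf; rewrite -!row_leq_rank tE => /leq_trans; apply; exact: mxrankM_maxr.
Qed.

End affine_independence_of_rows.

(** * Probability measures carried by finitely many points *)

Section finitely_supported_probability.
Context {d : measure_display} {T : measurableType d} {R : realType}.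
Context {n : nat} (p : 'I_n -> T).

Lemma exists_discrete_probability (t : 'I_n -> R) :
  (forall i, 0 <= t i) -> \sum_(i < n) t i = 1 ->
  exists mu : probability T R,
    forall B, mu B = (\sum_(i < n) t i * \1_B (p i))%:E.
Proof.
move=> t0 t1.
(* [msum] sums a sequence indexed by [nat], so the weighted Dirac masses are continued by the zero
   measure from index [n] on. *)
pose m (k : nat) : {measure set T -> \bar R} :=
  if insub k is Some i then mscale (NngNum (t0 i)) (dirac (p i)) else mzero.
have sumE B :
    (msum m n : {measure set T -> \bar R}) B = (\sum_(i < n) t i * \1_B (p i))%:E.
  rewrite /msum -sumEFin; apply: eq_bigr => i _.
  by rewrite /m valK /= /mscale /= diracE EFinM indicE.
(* The total mass is already 1: normalising changes no value and only supplies the structure of a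
   probability. [dirac point] is the default for a degenerate mass. *)
exists (mnormalize (msum m n) (dirac point)) => B.
rewrite /= /mnormalize. rewrite !sumE.
have -> : \sum_(i < n) t i * \1_[set: T] (p i) = 1.
  by rewrite -[RHS]t1; apply: eq_bigr => i _; rewrite indicT mulr1.
rewrite onee_eq0 /=. by rewrite invr1 mule1 sumE.
Qed.

Hypothesis p_inj : injective p.
Hypothesis mp : forall i, measurable [set p i].

Lemma range_fin_measurable : measurable (range p).
Proof.
rewrite (_ : range p = \bigcup_(i in [set: 'I_n]) [set p i]); last first.
  by apply/seteqP; split=> [_ [i _ <-]|_ [i _ ->]]; exists i.
by apply: fin_bigcup_measurable => //; exact: finite_finset.
Qed.

Variable nu : probability T R.
Hypothesis nup : nu (range p) = 1%E.

(** The complement of [range p] is null, so [f] agrees almost everywhere with the simple function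
    [\sum_i g i], whose integral is computed termwise. *)
Lemma integral_finite_support (K : set T) (f : T -> R) :
  measurable K -> range p `<=` K -> measurable_fun K f ->
  (\int[nu]_(y in K) (f y)%:E =
   (\sum_(i < n) fine (nu [set p i]) * f (p i))%:E)%E.
Proof.
move=> mK pK mf.
pose g i (y : T) := ((f (p i))%:E * (\1_[set p i] y)%:E)%E.
have ig i : nu.-integrable K (fun y => (\1_[set p i] y)%:E).
  by apply: (integrableS measurableT) => //; exact: integrable_indic.
rewrite (@ae_eq_integral _ _ _ nu K (fun y => \sum_(i < n) g i y)%E) //.
- rewrite integral_sum // => [|i]; last exact: integrableZl.
  rewrite -sumEFin; apply: eq_bigr => i _.
  rewrite integralZl // integral_indic // setIidl; last first.
    by move=> _ ->; exact: pK.
  by rewrite EFinM fineK ?fin_num_measure // muleC.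
- exact/measurable_EFinP.
- apply: emeasurable_sum => i.
  by apply: measurable_funeM; apply: measurable_int (ig i).
exists (~` range p); split.
- exact/measurableC/range_fin_measurable.
- rewrite -[LHS]/(nu (~` range p)) probability_setC ?nup ?subee //.
  exact: range_fin_measurable.
apply: subsetC => _ [i _ <-] _; rewrite (bigD1 i) //= big1 => [|j ji].
  by rewrite /g indicE mem_set // mule1 adde0.
rewrite /g indicE memNset ?mule0 // => /p_inj ij.
by rewrite ij eqxx in ji.
Qed.

Lemma measure_finite_support (B : set T) : measurable B ->
  nu B = (\sum_(i < n) fine (nu [set p i]) * \1_B (p i))%:E.
Proof.
move=> mB; rewrite -(@integral_finite_support setT) //.
by rewrite integral_indic // setIT.
Qed.

End finitely_supported_probability.

(** * Unique representing measures on a polytope *)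

Section choquet_polytope.
Context {R : realType} {E : tvsType R} {n : nat} (p : 'I_n -> E).
Local Notation K := (convex_hull (range p)).
Hypothesis hausE : hausdorff_space E.

Lemma closed_borel_measurable (B : set E) :
  closed B -> measurable (B : set (borel E)).
Proof.
move=> cB; rewrite -(setCK B); apply: measurableC.
by apply: sub_sigma_algebra; exact: closed_openC.
Qed.

Lemma set1_borel_measurable (y : E) : measurable ([set y] : set (borel E)).
Proof.
apply: closed_borel_measurable.
exact/accessible_closed_set1/hausdorff_accessible.
Qed.

Lemma continuous_borel_measurable (B : set (borel E)) (f : E -> R^o) :
  measurable B -> continuous f -> measurable_fun B (f : borel E -> R).
Proof.
move=> mB /continuousP cf; apply: (measurability _ (RGenOpens.measurableE R)).
move=> _ [_ [a [b ->] <-]]; apply: measurableI => //.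
by apply: sub_sigma_algebra; apply: cf; exact: interval_open.
Qed.

Hypothesis p_inj : injective p.
Hypothesis K_compact : compact K.
Hypothesis extK : extreme_points K = range p.

Let mp i : measurable ([set p i] : set (borel E)).
Proof. exact: set1_borel_measurable. Qed.

Let mK : measurable (K : set (borel E)).
Proof. exact: closed_borel_measurable (compact_closed hausE K_compact). Qed.

Let pK : range p `<=` K.
Proof. exact: sub_gen_smallest. Qed.

(** Reduces barycenters to finite sums, so that representing measures can be handled as weight
    vectors. *)
Lemma barycenter_extreme_support (nu : probability (borel E) R) (y : E) :
  nu (range p) = 1%E ->
  barycenter K nu y <->
  forall f : {linear E -> R^o}, continuous f ->
    \sum_(i < n) fine (nu [set p i]) * f (p i) = f y.
Proof.
move=> nup.
have intE (f : {linear E -> R^o}) : continuous f ->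
    (\int[nu]_(y in K) (f y)%:E =
     (\sum_(i < n) fine (nu [set p i]) * f (p i))%:E)%E.
  move=> cf; apply: integral_finite_support => //.
  exact: continuous_borel_measurable.
split=> b f cf; first by apply: EFin_inj; rewrite -intE // b.
by rewrite intE // b.
Qed.

Lemma represents_convex_combination (t : 'I_n -> R) :
  (forall i, 0 <= t i) -> \sum_(i < n) t i = 1 ->
  exists2 mu : probability (borel E) R,
    represents K mu (\sum_(i < n) t i *: p i) &
    forall i, mu [set p i] = (t i)%:E.
Proof.
move=> t0 t1.
have [mu muE] := exists_discrete_probability (p : 'I_n -> borel E) _ t0 t1.
have mup i : mu [set p i] = (t i)%:E.
  rewrite muE (bigD1 i) //= big1 => [|j ji].
    by rewrite indicE mem_set // mulr1 addr0.
  by rewrite indicE memNset ?mulr0 // => /p_inj ij; rewrite ij eqxx in ji.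
exists mu => //.
have mur : mu (range p) = 1%E.
  rewrite muE -t1; congr (_%:E); apply: eq_bigr => i _.
  by rewrite indicE mem_set ?mulr1 //; exists i.
split; first by rewrite extK.
apply/barycenter_extreme_support => // f cf.
rewrite linear_sum; apply: eq_bigr => i _.
by rewrite mup linearZ.
Qed.

Lemma choquet_simplex_affinely_independent :
  choquet_simplex K -> affinely_independent p.
Proof.
case=> _ _ _ _ uniq a a0 ap i.
(* The positive and negative parts of the relation [a]; they have the same total [s] because [a]
   sums to zero. *)
pose ap' j := Num.max (a j) 0; pose an j := Num.max (- a j) 0.
have aE j : a j = ap' j - an j.
  rewrite /ap' /an; have [aj|aj] := leP 0 (a j).
    by rewrite (max_idPr _) ?oppr_le0 // subr0.
  by rewrite (max_idPl _) ?oppr_ge0 ?ltW // sub0r opprK.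
have ap0 j : 0 <= ap' j by rewrite le_max lexx orbT.
have an0 j : 0 <= an j by rewrite le_max lexx orbT.
pose s := \sum_(j < n) ap' j.
have sE : \sum_(j < n) an j = s.
  apply/esym/eqP; rewrite -subr_eq0 -sumrB; apply/eqP.
  by rewrite -[RHS]a0; apply: eq_bigr => j _; rewrite -aE.
have s_ge0 : 0 <= s by apply: sumr_ge0.
(* Division by [s] is impossible here, but nonnegative parts of total zero vanish, and [a i] with
   them. *)
have [s0|s_neq0] := eqVneq s 0.
  have z (b : 'I_n -> R) :
      (forall j, 0 <= b j) -> \sum_(j < n) b j = 0 -> b i = 0.
    move=> b0 /eqP; rewrite psumr_eq0 // => /allP/(_ i).
    by rewrite mem_index_enum => /(_ isT)/eqP.
  by rewrite aE (z ap') // (z an) ?subr0 // sE.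
have divs_ge0 (b : 'I_n -> R) : (forall j, 0 <= b j) -> forall j, 0 <= b j / s.
  by move=> b0 j; rewrite divr_ge0.
have divs_sum (b : 'I_n -> R) :
    \sum_(j < n) b j = s -> \sum_(j < n) b j / s = 1.
  by move=> bs; rewrite -mulr_suml bs divff.
have [mu mur mup] :=
  represents_convex_combination _ (divs_ge0 _ ap0) (divs_sum ap' erefl).
have [nu nur nup] :=
  represents_convex_combination _ (divs_ge0 _ an0) (divs_sum _ sE).
have eqy : \sum_(j < n) (an j / s) *: p j = \sum_(j < n) (ap' j / s) *: p j.
  apply/esym/eqP; rewrite -subr_eq0 -sumrB; apply/eqP.
  rewrite -[RHS](scaler0 _ s^-1) -[X in _ = _ *: X]ap scaler_sumr.
  apply: eq_bigr => j _.
  by rewrite -scalerBl -mulrBl -aE scalerA mulrC.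
rewrite eqy in nur.
have Ky : K (\sum_(j < n) (ap' j / s) *: p j).
  rewrite convex_hull_rangeE; exists (fun j => ap' j / s); split=> //.
    exact: divs_ge0.
  exact: divs_sum.
(* Both measures equal the unique representing measure [la]; comparing them on [[set p i]] gives
   [ap' i = an i]. *)
have [la _ laE] := uniq _ Ky.
have := laE _ mur _ (mp i); rewrite -(laE _ nur _ (mp i)) mup nup => -[].
by move/(divIf s_neq0) => e; rewrite aE e subrr.
Qed.

(* By Hahn-Banach the last hypothesis holds in every Hausdorff E; for the
   sequence space it is witnessed by the coordinates. *)
Lemma affinely_independent_choquet_simplex :
  metrizable_set R K -> affinely_independent p ->
  (forall y : E, (forall f : {linear E -> R^o}, continuous f -> f y = 0) ->
    y = 0) ->
  choquet_simplex K.
Proof.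
move=> metK ai sep; split=> //; first exact: convex_set_convex_hull.
move=> y; rewrite {1}convex_hull_rangeE => -[t [t0 t1 ->]].
have [mu mur mup] := represents_convex_combination _ t0 t1.
exists mu => // nu [nue nub] B mB.
have nup : nu (range p) = 1%E by rewrite -extK.
have mup' : mu (range p) = 1%E by rewrite -extK; case: mur.
have supp := @measure_finite_support _ (borel E) R n p p_inj mp.
rewrite (supp _ nup) // (supp _ mup') //.
suff tE i : fine (nu [set p i]) = t i.
  by congr (_%:E); apply: eq_bigr => i _; rewrite tE mup.
apply/eqP; rewrite -subr_eq0; apply/eqP.
(* The differences of the two weight vectors form an affine relation: both total 1, and the two
   combinations of the [p i] agree under every continuous linear functional, hence are equal by
   [sep]. *)
apply: (ai (fun i => fine (nu [set p i]) - t i)).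
  rewrite sumrB t1; apply/eqP; rewrite subr_eq0; apply/eqP.
  have := nup; rewrite (supp _ nup) => [[e]|].
    rewrite -[RHS]e; apply: eq_bigr => j _.
    by rewrite indicE mem_set ?mulr1 //; exists j.
  exact: (@range_fin_measurable _ (borel E)).
apply: sep => f cf.
have /barycenter_extreme_support -/(_ nup f cf) := nub.
rewrite linear_sum => e.
under eq_bigr => j _ do rewrite scalerBl.
rewrite sumrB linearB /= !(linear_sum f) -e; apply/eqP; rewrite subr_eq0.
by apply/eqP/eq_bigr => j _; exact: linearZ.
Qed.

End choquet_polytope.

(** * Compactness of polytopes *)

Lemma compact_convex_hull (R : realType) (E : tvsType R) n (p : 'I_n -> E) :
  compact (convex_hull (range p)).
Proof.
(* The hull is the continuous image under [comb] of the standard simplex, a closed subset of a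
   compact cube. *)
pose simplex := [set v : 'rV[R]_n | forall i, `[0, 1]%classic (v ord0 i)] `&`
  [set v | \sum_(i < n) v ord0 i = 1].
pose comb (v : 'rV[R]_n) : E := \sum_(i < n) v ord0 i *: p i.
have -> : convex_hull (range p) = comb @` simplex.
  rewrite convex_hull_rangeE.
  apply/seteqP; split=> [y [t [t0 t1 ->]]|y [v [v0 v1] <-]].
    exists (\row_i t i); last by apply: eq_bigr => i _; rewrite mxE.
    split=> [i|] /=; last first.
      by rewrite -[RHS]t1; apply: eq_bigr => i _; rewrite mxE.
    rewrite mxE in_itv /= t0 /= -t1 (bigD1 i) //= lerDl.
    by apply: sumr_ge0.
  exists (fun i => v ord0 i); split=> // i.
  by have := v0 i; rewrite /= in_itv /= => /andP[].
apply: continuous_compact.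
  apply/continuous_subspaceT/continuous_big; first exact: add_continuous.
  move=> i _ v.
  apply: (@cvg_comp _ _ _ (fun v : 'rV[R]_n => (v ord0 i : R^o, p i))
    (fun z : R^o * E => z.1 *: z.2) _ (nbhs (v ord0 i : R^o, p i))).
    exact: (@cvg_pair _ _ _ (nbhs v) (nbhs (v ord0 i : R^o)) (nbhs (p i))
      _ _ _ _ _ (@coord_continuous R 1 n ord0 i v) (cvg_cst _)).
  exact: (@scale_continuous _ E (v ord0 i, p i)).
apply: (@subclosed_compact _ _
  [set v : 'rV[R]_n | forall i, `[0, 1]%classic (v ord0 i)]).
- apply: closedI.
    rewrite (_ : [set v | _] =
        \bigcap_i [set v : 'rV[R]_n | `[0, 1]%classic (v ord0 i)]); last first.
      by apply/seteqP; split=> v h i; [move=> _ /=; exact: h|exact: (h i I)].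
    apply: closed_bigI => i _.
    exact: (proj1 (continuous_closedP _) (@coord_continuous R 1 n ord0 i) _
      (@interval_closed R _ _ _ _)).
  have c : continuous (fun v : 'rV[R]_n => \sum_(i < n) v ord0 i).
    apply: continuous_big => [|i _]; first exact: add_continuous.
    exact: coord_continuous.
  exact: (proj1 (continuous_closedP _) c _ (@closed_eq R 1)).
- apply: (@rV_compact R n (fun=> `[0, 1]%classic)) => i.
  exact: segment_compact.
- by move=> v [].
Qed.

(** * Coordinates, separation and metrizability in the sequence space *)

Section real_sequence_topology.
Variable R : realType.
Local Notation E := (real_sequence R).

(** Evaluation gets a name so that it can carry the linear structure expected of test
    functionals. *)
Definition coordinate (n : nat) (g : E) : R^o := g n.

Fact coordinate_is_linear n : linear (coordinate n).
Proof. by []. Qed.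

HB.instance Definition _ n :=
  GRing.isLinear.Build R E R^o *:%R (coordinate n) (coordinate_is_linear n).

Lemma coordinate_continuous n : continuous (coordinate n).
Proof. exact: (@proj_continuous nat (fun=> R^o)). Qed.

Lemma cvg_real_sequence (F : set_system E) (f : E) : Filter F ->
  (forall n, coordinate n @ F --> coordinate n f) -> F --> f.
Proof.
move=> FF cf; apply/cvg_sup => n U [V [[W oW <-]]] WfN WU.
by apply: (filterS WU); apply: cf; apply: open_nbhs_nbhs; split.
Qed.

Lemma hausdorff_real_sequence : hausdorff_space E.
Proof.
by apply: (@hausdorff_product nat (fun=> R^o)) => _; exact: Rhausdorff.
Qed.

(** The metric is the l1 distance over the selected coordinates. On [K] every coordinate repeats a
    selected one, so this distance bounds all coordinate differences. *)
Lemma metrizable_finitely_determined (K : set E) m (s : 'I_m -> nat)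
    (j : nat -> 'I_m) :
  (forall y n, K y -> y n = y (s (j n))) -> metrizable_set R K.
Proof.
move=> Ks; pose rho (y z : E) := \sum_(i < m) `|y (s i) - z (s i)|.
have rho_coord y z n : K y -> K z -> `|y n - z n| <= rho y z.
  move=> Ky Kz; rewrite (Ks _ _ Ky) (Ks _ _ Kz) /rho (bigD1 (j n)) //= lerDl.
  exact: sumr_ge0.
have rho0 y : rho y y = 0 by rewrite /rho big1 // => i _; rewrite subrr normr0.
exists rho; split=> [y z Ky Kz|y z _ _|y z w _ _ _|y U Ky].
- split=> [r0|->//]; apply/funext => n; apply/eqP; rewrite -subr_eq0 -normr_le0.
  by rewrite -r0 rho_coord.
- by apply: eq_bigr => i _; exact: distrC.
- by rewrite /rho -big_split ler_sum // => i _; exact: ler_distD.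
split=> [yU|[e e0 yU]].
  (* The filter of [rho]-balls in [K] around [y] converges to [y] coordinatewise, so each
     neighbourhood of [y] contains such a ball. *)
  pose F := filter_from [set e : R | 0 < e]
    (fun e => [set z | K z /\ rho y z < e]).
  have FF : Filter F.
    apply: filter_from_filter; first by exists 1 => /=.
    move=> a b a0 b0; exists (Num.min a b); first by rewrite /= lt_min a0.
    by move=> z /= [Kz]; rewrite lt_min => /andP[].
  have Fy : F --> y.
    apply: cvg_real_sequence => n; apply/cvgrPdist_lt => e e0.
    exists e => // z [Kz]; apply: le_lt_trans; exact: rho_coord.
  have [e e0 eU] := Fy _ yU.
  by exists e => // z Kz yz; apply: eU.
(* For the converse, continuity of [rho y] makes balls around [y] neighbourhoods of [y]. *)
have c : continuous (rho y).
  apply: continuous_big => [|i _]; first exact: add_continuous.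
  move=> z; apply: (@cvg_norm R R^o _ (nbhs z) _
    (fun w : E => y (s i) - coordinate (s i) w) (y (s i) - coordinate (s i) z)).
  apply: (@cvgB R R^o _ (nbhs z) _ (fun=> y (s i)) (coordinate (s i))).
    exact: cvg_cst.
  exact: coordinate_continuous.
have := c y; rewrite /continuous_at rho0 => /cvgrPdist_lt/(_ e e0).
apply: filterS => z; rewrite sub0r normrN ger0_norm ?sumr_ge0 // => yz Kz.
exact: yU.
Qed.

End real_sequence_topology.

(** * Finite metric spaces and their image in the sequence space *)

Lemma dense_finite_surjective (T : topologicalType) (I : finType) (x : I -> T)
    (D : nat -> T) :
  accessible_space T -> (forall u, exists i, x i = u) -> dense (range D) ->
  forall u, exists k, D k = u.
Proof.
move=> T1 xsurj dD u.
have ou : open [set u].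
  (* Singletons are open, as their complements are finite and hence closed; a dense range must meet
     each of them. *)
  rewrite -[[set u]]setCK; apply: closed_openC.
  apply: (accessible_finite_set_closed.1 T1).
  apply: (@sub_finite_set _ _ (range x)); last exact: finite_image.
  by move=> v _; have [i <-] := xsurj v; exists i.
have [|v [-> [k _ <-]]] := dD [set u] _ ou; first by exists u.
by exists k.
Qed.

Section finite_metric_space.
Context {R : realType} {X : metricType R} {m : nat} (x : 'I_m -> X).
Hypothesis x_bij : bijective x.
Variable D : nat -> X.
Hypothesis D_dense : dense (range D).

Local Notation p := (fun i => dist_seq D (x i)).

Let x_surj u : exists i, x i = u.
Proof. by have [xi _ xiK] := x_bij; exists (xi u). Qed.

Let D_surj u : exists k, D k = u.
Proof.
apply: dense_finite_surjective x_surj D_dense u.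
by apply: hausdorff_accessible; exact: metric_hausdorff.
Qed.

(** When [x k = D n], coordinate [n] of a combination of the sequences is entry [k] of the same
    combination of rows. Surjectivity of [x] and of [D] matches every coordinate with an entry and
    conversely. *)
Lemma affinely_independent_dist_seq :
  affinely_independent p <-> affinely_independent (fun i => row i (dist_mx x)).
Proof.
have sumE (a : 'I_m -> R) k n : x k = D n ->
    (\sum_(i < m) a i *: p i) n = (\sum_(i < m) a i *: row i (dist_mx x)) 0 k.
  move=> xkD; rewrite -[LHS]/(coordinate _ n _) linear_sum summxE.
  apply: eq_bigr => i _.
  by rewrite linearZ !mxE xkD.
split=> ai a a0 ap; apply: (ai _ a0).
  apply/funext => n; have [k xk] := x_surj (D n).
  by rewrite (sumE _ _ _ xk) ap mxE.
apply/rowP => k; have [n Dn] := D_surj (x k).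
by rewrite -(sumE _ _ _ (esym Dn)) ap mxE.
Qed.

(** The hull of finitely many points is compact, hence already closed in a Hausdorff space. *)
Lemma Sprime_convex_hull : Sprime D = convex_hull (range p).
Proof.
rewrite /Sprime (_ : range (dist_seq D) = range p); last first.
  apply/seteqP; split=> [_ [u _ <-]|_ [i _ <-]]; last by exists (x i).
  by have [i <-] := x_surj u; exists i.
apply/esym/closure_id; apply: compact_closed; last exact: compact_convex_hull.
exact: hausdorff_real_sequence.
Qed.

Lemma extreme_points_dist_seq :
  extreme_points (convex_hull (range p)) = range p.
Proof.
apply/seteqP; split; first exact: extreme_points_convex_hull.
move=> _ [i _ <-]; have [n Dn] := D_surj (x i).
apply: (@exposed_point_convex_hull _ _ _ p i (coordinate R n)).
  by rewrite -[LHS]/(mdist (x i) (D n)) Dn mdistxx.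
move=> k ki; rewrite -[ltRHS]/(mdist (x k) (D n)) Dn mdist_gt0.
by apply: contra_neq ki => /(bij_inj x_bij).
Qed.

Lemma dist_seq_inj : injective p.
Proof.
move=> i k pik; have [n Dn] := D_surj (x i); apply: (bij_inj x_bij).
have : p i n = p k n by rewrite pik.
by rewrite /dist_seq Dn mdistxx => /esym/mdist_positivity ->.
Qed.

(** Coordinate [n] depends only on the point [D n], so one index for each point of the space
    determines all coordinates. *)
Lemma metrizable_Sprime : metrizable_set R (convex_hull (range p)).
Proof.
have [s Ds] := choice (fun i => D_surj (x i)).
have [j xj] := choice (fun n => x_surj (D n)).
apply: (@metrizable_finitely_determined R _ m s j) => y n.
rewrite convex_hull_rangeE => -[t [_ _ ->]].
rewrite -[LHS]/(coordinate _ n _) -[RHS]/(coordinate _ (s (j n)) _) !linear_sum.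
apply: eq_bigr => i _.
by rewrite !linearZ /= /coordinate /dist_seq Ds xj.
Qed.

Lemma choquet_simplex_Sprime :
  choquet_simplex (Sprime D) <->
  affinely_independent (fun i => row i (dist_mx x)).
Proof.
rewrite Sprime_convex_hull -affinely_independent_dist_seq.
have haus := @hausdorff_real_sequence R.
have cK := @compact_convex_hull R _ m p.
split.
  exact: (choquet_simplex_affinely_independent p haus dist_seq_inj cK
    extreme_points_dist_seq).
move=> ai; apply: affinely_independent_choquet_simplex => //.
- exact: dist_seq_inj.
- exact: extreme_points_dist_seq.
- exact: metrizable_Sprime.
move=> y y0; apply/funext => n.
exact: (y0 (coordinate R n) (@coordinate_continuous R n)).
Qed.

(** Row freeness concerns the left kernel, the other condition column vectors; symmetry of the
    metric makes [dist_mx x] its own transpose and lets one pass between them. *)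
Lemma row_free_dist_mx_kernel :
  row_free (row_mx (const_mx 1 : 'cV[R]_m) (dist_mx x)) <->
  [set a : 'cV[R]_m | dist_mx x *m a = 0] `&`
    [set a : 'cV[R]_m | \sum_(i < m) a i 0 = 0] = [set 0].
Proof.
have distT : (dist_mx x)^T = dist_mx x.
  by apply/matrixP => i j; rewrite !mxE metric_sym.
rewrite -affinely_independent_row_free; split=> [ai|ker a a0 a1 i].
  apply/seteqP; split=> [a [/= Ma a0]|_ ->]; last first.
    by split=> /=; rewrite ?mulmx0 // big1 // => i _; rewrite mxE.
  apply/colP => i; rewrite mxE; apply: (ai (fun i => a i 0)) => //.
  transitivity (dist_mx x *m a)^T; last by rewrite Ma trmx0.
  rewrite trmx_mul distT mulmx_sum_row.
  by apply: eq_bigr => j _; rewrite mxE.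
have : [set 0] (\col_i a i : 'cV[R]_m).
  rewrite -ker; split=> /=.
    apply: trmx_inj; rewrite trmx_mul distT mulmx_sum_row trmx0 -[RHS]a1.
    by apply: eq_bigr => j _; rewrite !mxE.
  by rewrite -[RHS]a0; apply: eq_bigr => j _; rewrite mxE.
by move=> /colP/(_ i); rewrite !mxE.
Qed.

End finite_metric_space.

(** * The cycle of implications between the five conditions *)

Theorem theorem2p4 (R : realType) (X : metricType R) (m : nat)
    (x : 'I_m -> X) (x_bij : bijective x)
    (diam_le1 : forall u v : X, mdist u v <= 1)
    (D : nat -> X) (D_dense : dense (range D)) :
  [<-> choquet_simplex (Sprime D);
       is_simplex m.-1 (convex_hull (range (fun i => row i (dist_mx x))));
       affinely_independent (fun i => row i (dist_mx x));
       \rank (row_mx (const_mx 1 : 'cV[R]_m) (dist_mx x)) = m;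
       [set a : 'cV[R]_m | dist_mx x *m a = 0] `&`
         [set a : 'cV[R]_m | \sum_(i < m) a i 0 = 0] = [set 0]].
Proof.
case: m x x_bij => [|n] x x_bij.
  (* The case [m = 0] is void, since [D 0] is a point of the space; from here on [m.-1] is a true
     predecessor. *)
  by have [xi _ _] := x_bij; case: (xi (D 0)).
have rankP : row_free (row_mx (const_mx 1 : 'cV[R]_n.+1) (dist_mx x)) <->
    \rank (row_mx (const_mx 1 : 'cV[R]_n.+1) (dist_mx x)) = n.+1.
  by rewrite /row_free; split=> /eqP.
tfae.
- move=> /(choquet_simplex_Sprime x x_bij D D_dense) ai.
  by exists (fun i => row i (dist_mx x)).
(* The vertices [q] are not assumed to be the rows; equality of the hulls only places them in the
   hull of the rows. *)
- move=> [q [qi hullE]]; apply: affinely_independent_spanning qi.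
  by rewrite hullE; exact: sub_gen_smallest.
- by move=> /affinely_independent_row_free/rankP.
- by move=> /rankP/row_free_dist_mx_kernel.
- move=> /row_free_dist_mx_kernel/affinely_independent_row_free.
  by move=> /(choquet_simplex_Sprime x x_bij D D_dense).
Qed.
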